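(* (i) Let $f:M\twoheadrightarrow N$ be an epimorphism of p.f.d. persistence modules. Then, for all $t\in\mathbb R$, $D^{\twoheadrightarrow}(f)_t$ is an order-preserving epimorphism in $\mathbf{Mch}$. Moreover, these matchings are natural, so they define an epimorphism $$D^{\twoheadrightarrow}(f):D^{\twoheadrightarrow}(M)\twoheadrightarrow D^{\twoheadrightarrow}(N)$$ in a functorial way, i.e., $D^{\twoheadrightarrow}(g\circ f)=D^{\twoheadrightarrow}(g)\circ D^{\twoheadrightarrow}(f)$ for any epimorphism $g:N\twoheadrightarrow O$ of p.f.d. persistence modules. (ii) Let $f:M\hookrightarrow N$ be a monomorphism of p.f.d. persistence modules. Then, for all $t\in\mathbb R$, $D^{\hookrightarrow}(f)_t$ is an order-preserving monomorphism in $\mathbf{Mch}$. Moreover, these matchings are natural, so they define a monomorphism $$D^{\hookrightarrow}(f):D^{\hookrightarrow}(M)\hookrightarrow D^{\hookrightarrow}(N)$$ in a functorial way, i.e., $D^{\hookrightarrow}(g\circ f)=D^{\hookrightarrow}(g)\circ D^{\hookrightarrow}(f)$ for any monomorphism $g:N\hookrightarrow O$ of p.f.d. persistence modules.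
   Context: $\mathbb N=\{1,2,3,\dots\}$. A pointwise finite dimensional (p.f.d.) persistence module is a functor $M$ from the poset category $\mathbf R$ of real numbers to finite dimensional vector spaces over a fixed field, with internal maps $M_{s,t}:M_s\to M_t$ for $s\le t$; morphisms are natural transformations. $\mathbf{Mch}$ is the category of sets and matchings (partial injective functions), composed as relations; monomorphisms are the injections (every source element matched), epimorphisms the coinjections (every target element matched). $\mathbf{Mch}^{\mathbf R}$ is the category of functors $\mathbf R\to\mathbf{Mch}$. A matching $\sigma$ between totally ordered sets is order-preserving if $(i,j),(m,n)\in\sigma$ and $j<n$ imply $i<m$. For a p.f.d. persistence module $M$, the functors $D^{\twoheadrightarrow}(M),D^{\hookrightarrow}(M):\mathbf R\to\mathbf{Mch}$ are given by $D^{\twoheadrightarrow}(M)_t=D^{\hookrightarrow}(M)_t=\{1,\dots,\dim M_t\}$ and, for $t\le u$, $$D^{\twoheadrightarrow}(M)_{t,u}=\{(i,j)\in\mathbb N^2\mid j\le\operatorname{rank}M_{t,u},\ i=j+\max\{\operatorname{rank}M_{s,t}-\operatorname{rank}M_{s,u}\mid s<t,\ \operatorname{rank}M_{s,u}<j\}\},$$ $$D^{\hookrightarrow}(M)_{t,u}=\{(i,j)\in\mathbb N^2\mid i\le\operatorname{rank}M_{t,u},\ j=i+\max\{\operatorname{rank}M_{u,v}-\operatorname{rank}M_{t,v}\mid v>u,\ \operatorname{rank}M_{t,v}<i\}\}$$ (that these are functors is a known fact). For an epimorphism $f:M\twoheadrightarrow N$, $$D^{\twoheadrightarrow}(f)_t=\{(i,j)\in\mathbb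 N^2\mid j\le\dim N_t,\ i=j+\max\{\operatorname{rank}M_{s,t}-\operatorname{rank}N_{s,t}\mid s<t,\ \operatorname{rank}N_{s,t}<j\}\},$$ and for a monomorphism $f:M\hookrightarrow N$, $$D^{\hookrightarrow}(f)_t=\{(i,j)\in\mathbb N^2\mid i\le\dim M_t,\ j=i+\max\{\operatorname{rank}N_{t,v}-\operatorname{rank}M_{t,v}\mid v>t,\ \operatorname{rank}M_{t,v}<i\}\}.$$ In all formulas the maximum over an empty set is $0$. $D^{\twoheadrightarrow}(f)_t$ and $D^{\hookrightarrow}(f)_t$ are regarded as relations from $\{1,\dots,\dim M_t\}$ to $\{1,\dots,\dim N_t\}$. *)

(* Defs.v *)
From HB Require Import structures.
From mathcomp Require Import all_boot all_order all_algebra zify.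
From mathcomp Require Import boolp classical_sets reals.

Set Implicit Arguments.
Unset Strict Implicit.
Unset Printing Implicit Defensive.

Import Order.TTheory.

Local Open Scope classical_set_scope.

#[local] Obligation Tactic := idtac.

Record category := Category {
  ob :> Type;
  mor : ob -> ob -> Type;
  idm : forall x, mor x x;
  mcomp : forall x y z, mor y z -> mor x y -> mor x z;
  mcomp1m : forall x y (f : mor x y), mcomp (idm y) f = f;
  mcompm1 : forall x y (f : mor x y), mcomp f (idm x) = f;
  mcompA : forall x y z w (h : mor z w) (g : mor y z) (f : mor x y),
    mcomp h (mcomp g f) = mcomp (mcomp h g) f }.

Arguments mor {c} _ _.
Arguments idm {c} x.
Arguments mcomp {c x y z} _ _.

Definition is_mono (C : category) (x y : C) (f : mor x y) : Prop :=
  forall (z : C) (g h : mor z x), mcomp f g = mcomp f h -> g = h.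

Definition is_epi (C : category) (x y : C) (f : mor x y) : Prop :=
  forall (z : C) (g h : mor y z), mcomp g f = mcomp h f -> g = h.

Record functor (C D : category) := Functor {
  fob :> C -> D;
  fmap : forall x y : C, mor x y -> mor (fob x) (fob y);
  fmap1 : forall x, fmap (idm x) = idm (fob x);
  fmapM : forall x y z (g : mor y z) (f : mor x y),
    fmap (mcomp g f) = mcomp (fmap g) (fmap f) }.

Record nat_trans (C D : category) (F G : functor C D) := NatTrans {
  component :> forall x : C, mor (F x) (G x);
  naturality : forall (x y : C) (f : mor x y),
    mcomp (component y) (fmap F f) = mcomp (fmap G f) (component x) }.

Lemma nat_transP (C D : category) (F G : functor C D) (a b : nat_trans F G) :
  (forall x, a x = b x) -> a = b.
Proof.
case: a b => [a Na] [b Nb] /= ab.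
have {}ab : a = b by apply: functional_extensionality_dep.
by case: _ / ab Nb => Nb; congr NatTrans; exact: Prop_irrelevance.
Qed.

Lemma nat_trans_id_subproof (C D : category) (F : functor C D)
  (x y : C) (f : mor x y) :
  mcomp (idm (F y)) (fmap F f) = mcomp (fmap F f) (idm (F x)).
Proof. by rewrite mcomp1m mcompm1. Qed.

Definition nat_trans_id (C D : category) (F : functor C D) : nat_trans F F :=
  NatTrans (@nat_trans_id_subproof C D F).

Lemma nat_trans_comp_subproof (C D : category) (F G H : functor C D)
  (b : nat_trans G H) (a : nat_trans F G) (x y : C) (f : mor x y) :
  mcomp (mcomp (b y) (a y)) (fmap F f) = mcomp (fmap H f) (mcomp (b x) (a x)).
Proof. by rewrite -mcompA naturality mcompA naturality mcompA. Qed.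

Definition nat_trans_comp (C D : category) (F G H : functor C D)
    (b : nat_trans G H) (a : nat_trans F G) : nat_trans F H :=
  NatTrans (nat_trans_comp_subproof b a).

Program Definition functor_cat (C D : category) : category :=
  @Category (functor C D) (@nat_trans C D)
    (@nat_trans_id C D) (@nat_trans_comp C D) _ _ _.
Next Obligation. by move=> *; apply: nat_transP => ?; exact: mcomp1m. Qed.
Next Obligation. by move=> *; apply: nat_transP => ?; exact: mcompm1. Qed.
Next Obligation. by move=> *; apply: nat_transP => ?; exact: mcompA. Qed.

Program Definition poset_cat (d : Order.disp_t) (T : porderType d) : category :=
  @Category T (fun s t => (s <= t)%O) (fun t => lexx t)
    (fun s t u htu hst => le_trans hst htu) _ _ _.
Next Obligation. by move=> *; exact: bool_irrelevance. Qed.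
Next Obligation. by move=> *; exact: bool_irrelevance. Qed.
Next Obligation. by move=> *; exact: bool_irrelevance. Qed.

Program Definition vect_cat (K : fieldType) : category :=
  @Category (vectType K) (fun U V => 'Hom(U, V)) (fun U => \1%VF)
    (fun U V W g f => (g \o f)%VF) _ _ _.
Next Obligation. by move=> *; exact: comp_lfun1l. Qed.
Next Obligation. by move=> *; exact: comp_lfun1r. Qed.
Next Obligation. by move=> *; exact: comp_lfunA. Qed.

Record matching (A B : Type) := Matching {
  mrel :> A -> B -> Prop;
  matching_fun : forall a b b', mrel a b -> mrel a b' -> b = b';
  matching_inj : forall a a' b, mrel a b -> mrel a' b -> a = a' }.

Lemma matchingP (A B : Type) (s t : matching A B) :
  (forall a b, s a b <-> t a b) -> s = t.
Proof.
case: s t => [s s1 s2] [t t1 t2] /= st.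
have {}st : s = t by apply/funext => a; apply/funext => b; apply/propext.
by case: _ / st t1 t2 => t1 t2; congr Matching; exact: Prop_irrelevance.
Qed.

Program Definition matching_id (A : Type) : matching A A :=
  @Matching A A (fun a b => a = b) _ _.
Next Obligation. by move=> A a b b' -> ->. Qed.
Next Obligation. by move=> A a a' b -> ->. Qed.

Program Definition matching_comp (A B C : Type)
    (t : matching B C) (s : matching A B) : matching A C :=
  @Matching A C (fun a c => exists2 b, s a b & t b c) _ _.
Next Obligation.
move=> A B C t s a c c' [b ab bc] [b' ab' bc'].
by move: bc'; rewrite -(matching_fun ab ab') => /(matching_fun bc).
Qed.
Next Obligation.
move=> A B C t s a a' c [b ab bc] [b' ab' bc'].
by move: ab'; rewrite -(matching_inj bc bc') => /(matching_inj ab).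
Qed.

Program Definition Mch : category :=
  @Category Type matching matching_id matching_comp _ _ _.
Next Obligation.
by move=> A B f; apply: matchingP => a b; split => [[c ac <-]//|ab]; exists b.
Qed.
Next Obligation.
by move=> A B f; apply: matchingP => a b; split => [[c <-]//|ab]; exists a.
Qed.
Next Obligation.
move=> A B C D h g f; apply: matchingP => a d; split.
  by move=> [c [b ab bc] cd]; exists b => //; exists c.
by move=> [b ab [c bc cd]]; exists c => //; exists b.
Qed.

Definition order_preserving (d d' : Order.disp_t) (A : orderType d)
    (B : orderType d') (s : matching A B) : Prop :=
  forall (i m : A) (j n : B), s i j -> s m n -> (j < n)%O -> (i < m)%O.

(* The set {1, ..., n}. *)
Definition initial (n : nat) : Type := {i : nat | (0 < i <= n)%N}.

HB.instance Definition _ (n : nat) :=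
  SubType.copy (initial n) {i : nat | (0 < i <= n)%N}.
HB.instance Definition _ (n : nat) := Choice.on (initial n).
HB.instance Definition _ (n : nat) :=
  [SubChoice_isSubOrder of initial n by <: with Order.NatOrder.nat_display].

Definition pers_mod (R : realType) (K : fieldType) : category :=
  functor_cat (poset_cat R) (vect_cat K).

Definition pers_dim (R : realType) (K : fieldType) (M : pers_mod R K) (t : R) :
    nat :=
  \dim {: M t}.

(* The rank of M_{s,t}, with the junk value 0 when s <= t fails. *)
Definition rank (R : realType) (K : fieldType) (M : pers_mod R K) (s t : R) :
    nat :=
  if @idP (s <= t)%O is ReflectT st then \dim (limg (fmap M st)) else 0.

Lemma rankE (R : realType) (K : fieldType) (M : pers_mod R K) (s t : R)
  (st : (s <= t)%O) : rank M s t = \dim (limg (fmap M st)).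
Proof.
rewrite /rank; case: {-}_ / idP => [st'|//].
by rewrite (bool_irrelevance st' st).
Qed.

Lemma rank_id (R : realType) (K : fieldType) (M : pers_mod R K) (t : R) :
  rank M t t = pers_dim M t.
Proof. by rewrite (rankE M (lexx t)) (fmap1 M t) lim1g. Qed.

Lemma fmap_le_trans (R : realType) (K : fieldType) (M : pers_mod R K)
  (s t u : R) (st : (s <= t)%O) (tu : (t <= u)%O) :
  limg (fmap M (le_trans st tu)) = (fmap M tu @: limg (fmap M st))%VS.
Proof. by rewrite -limg_comp; congr lfun_img; exact: (fmapM M). Qed.

(* Three inequalities satisfied by the ranks of a persistence module; they are
   invariant under reversal of the order. *)
Definition rank_like (d : Order.disp_t) (T : porderType d) (r : T -> T -> nat) :
    Prop :=
  [/\ forall s s' t, (s <= s')%O -> (s' <= t)%O -> (r s t <= r s' t)%N,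
      forall s t t', (s <= t)%O -> (t <= t')%O -> (r s t' <= r s t)%N
    & forall s s' t t', (s <= s')%O -> (s' <= t)%O -> (t <= t')%O ->
        (r s t + r s' t' <= r s' t + r s t')%N].

Lemma rank_like_rank (R : realType) (K : fieldType) (M : pers_mod R K) :
  rank_like (rank M).
Proof.
have im s s' t (ss' : (s <= s')%O) (s't : (s' <= t)%O) :
    (limg (fmap M (le_trans ss' s't)) <= limg (fmap M s't))%VS.
  by rewrite fmap_le_trans limgS// subvf.
split.
- move=> s s' t ss' s't.
  by rewrite (rankE M (le_trans ss' s't)) (rankE M s't) dimvS.
- move=> s t t' st tt'.
  rewrite (rankE M (le_trans st tt')) (rankE M st) fmap_le_trans.
  by rewrite -[leqRHS](limg_ker_dim (fmap M tt')) leq_addl.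
- move=> s s' t t' ss' s't tt'; have st := le_trans ss' s't.
  rewrite (rankE M (le_trans s't tt')) (rankE M (le_trans st tt')).
  rewrite (rankE M st) (rankE M s't) !fmap_le_trans.
  rewrite -[\dim (limg (fmap M st))](limg_ker_dim (fmap M tt')).
  rewrite -[\dim (limg (fmap M s't))](limg_ker_dim (fmap M tt')).
  rewrite addnAC leq_add2r leq_add2r dimvS// capvS//.
  by rewrite (bool_irrelevance st (le_trans ss' s't)).
Qed.

(* The maximum of A, being 0 if A is empty. The sets of differences of ranks
   below are bounded, so that the junk value 0 at unbounded sets is irrelevant;
   moreover those differences are nonnegative, so that the truncated
   subtraction of nat is the true one. *)
Definition max0 (A : set nat) : nat :=
  xget 0 [set n | A n /\ forall m, A m -> (m <= n)%N].

Lemma max0_set0 : max0 set0 = 0.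
Proof. by rewrite /max0; case: xgetP => // n _ []. Qed.

Lemma max0P (A : set nat) (b : nat) : (forall n, A n -> (n <= b)%N) ->
  (forall n, A n -> (n <= max0 A)%N) /\ (A (max0 A) \/ A = set0 /\ max0 A = 0).
Proof.
move=> Ab; have [->|/set0P[n An]] := eqVneq A set0.
  by rewrite max0_set0; split=> //; right.
suff /(@xgetPex _ 0) [? ?] :
  exists n, A n /\ forall m, A m -> (m <= n)%N by split => //; left.
have exA : exists n, `[< A n >] by exists n; apply/asboolP.
have bA i : `[< A i >] -> (i <= b)%N by move=> /asboolP /Ab.
case: (ex_maxnP exA bA) => m /asboolP Am mmax.
by exists m; split => // k Ak; apply/mmax/asboolP.
Qed.

Definition D_epi_rel (R : realType) (K : fieldType) (M : pers_mod R K)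
    (t u : R) (i j : nat) : Prop :=
  (j <= rank M t u)%N /\
  i = j + max0 [set (rank M s t - rank M s u)%N
                 | s in [set s | (s < t)%O /\ (rank M s u < j)%N]].

Definition D_mono_rel (R : realType) (K : fieldType) (M : pers_mod R K)
    (t u : R) (i j : nat) : Prop :=
  (i <= rank M t u)%N /\
  j = i + max0 [set (rank M u v - rank M t v)%N
                 | v in [set v | (u < v)%O /\ (rank M t v < i)%N]].

Definition offset (d : Order.disp_t) (T : porderType d) (a b : T -> nat)
    (x : T) (k : nat) : nat :=
  max0 [set (a s - b s)%N | s in [set s | (s < x)%O /\ (b s < k)%N]].

Lemma offsetP (d : Order.disp_t) (T : porderType d) (a b : T -> nat) (x : T)
    (k : nat) :
  (forall s, (s <= x)%O -> (b s <= a s)%N) ->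
  (forall s, (s <= x)%O -> (a s + b x <= a x + b s)%N) ->
  (forall s, (s < x)%O -> (b s < k)%N -> (a s <= offset a b x k + b s)%N) /\
  ((exists s, [/\ (s < x)%O, (b s < k)%N & (offset a b x k + b s = a s)%N])
   \/ (forall s, (s < x)%O -> (k <= b s)%N) /\ offset a b x k = 0).
Proof.
move=> ba mon.
have bd n : [set (a s - b s)%N | s in [set s | (s < x)%O /\ (b s < k)%N]] n ->
    (n <= a x)%N.
  by move=> [s [/ltW sx _] <-]; have := mon _ sx; have := ba _ sx; lia.
have [ub wit] := max0P bd; rewrite -/(offset a b x k) in ub wit.
split=> [s sx sk|].
  have : (a s - b s <= offset a b x k)%N by apply: ub; exists s.
  lia.
case: wit => [[s [sx sk] sE]|[A0 ->]].
  by left; exists s; split=> //; rewrite -sE subnK// ba// ltW.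
right; split=> // s sx; rewrite leqNgt; apply/negP => sk.
by have : set0 (a s - b s)%N by rewrite -A0; exists s.
Qed.

Definition rank_rel (d : Order.disp_t) (T : porderType d) (r : T -> T -> nat)
    (t u : T) (i j : nat) : Prop :=
  (j <= r t u)%N /\ i = j + offset (r^~ t) (r^~ u) t j.

Lemma offset_rank (d : Order.disp_t) (T : porderType d) (r : T -> T -> nat)
    (t u : T) (k : nat) (o := offset (r^~ t) (r^~ u) t k) :
  rank_like r -> (t <= u)%O ->
  (forall s, (s < t)%O -> (r s u < k)%N -> (r s t <= o + r s u)%N) /\
  ((exists s, [/\ (s < t)%O, (r s u < k)%N & (o + r s u = r s t)%N])
   \/ (forall s, (s < t)%O -> (k <= r s u)%N) /\ o = 0).
Proof.
move=> [_ r2 r3] tu; apply: offsetP => s st; first exact: r2.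
exact: r3.
Qed.

Lemma rank_rel_range (d : Order.disp_t) (T : porderType d) (r : T -> T -> nat)
    (t u : T) (i j : nat) : rank_like r -> (t <= u)%O ->
  rank_rel r t u i j -> (j <= i <= r t t)%N && (j <= r u u)%N.
Proof.
move=> rr tu [jr ->]; rewrite leq_addr/=.
have [r1 r2 r3] := rr; have := r1 _ _ _ tu (lexx u).
have := r2 _ _ _ (lexx t) tu.
have [_ [[s [st _ os]]|[_ ->]]] := offset_rank j rr tu; last by lia.
by have := r3 _ _ _ _ (ltW st) (lexx t) tu; lia.
Qed.

Lemma rank_rel_id (d : Order.disp_t) (T : porderType d) (r : T -> T -> nat)
    (t : T) (i j : nat) : rank_like r ->
  rank_rel r t t i j <-> (j <= r t t)%N /\ i = j.
Proof.
move=> rr; rewrite /rank_rel.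
suff -> : offset (r^~ t) (r^~ t) t j = 0 by rewrite addn0.
by have [_ [[s [_ _]]|[_ //]]] := offset_rank j rr (lexx t); lia.
Qed.

Lemma rank_rel_fun (d : Order.disp_t) (T : porderType d) (r : T -> T -> nat)
    (t u : T) (i j j' : nat) : rank_like r -> (t <= u)%O ->
  rank_rel r t u i j -> rank_rel r t u i j' -> j = j'.
Proof.
move=> rr tu [_ ij] [_ ij'].
have [m [[s [st sj so]]|[_ o0]]] := offset_rank j rr tu;
have [m' [[s' [st' sj' so']]|[_ o0']]] := offset_rank j' rr tu.
- have := m' _ st; have := m _ st'; lia.
- have := m' _ st; lia.
- have := m _ st'; lia.
- lia.
Qed.

Lemma rank_rel_comp (d : Order.disp_t) (T : orderType d) (r : T -> T -> nat)
    (t u v : T) (i k : nat) : rank_like r -> (t <= u)%O -> (u <= v)%O ->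
  (exists2 j, rank_rel r t u i j & rank_rel r u v j k) <-> rank_rel r t v i k.
Proof.
move=> rr tu uv; have tv := le_trans tu uv; have [r1 r2 r3] := rr.
set o := offset (r^~ u) (r^~ v) u k.
have [om ow] := offset_rank k rr uv; rewrite -/o in om ow.
(* k <= r t v iff k + o <= r t u, for k <= r u v *)
have kP : (k <= r t v)%N <-> (k <= r u v)%N /\ (k + o <= r t u)%N.
  split=> [ktv|[kuv kotu]].
    split; first exact: leq_trans ktv (r1 _ _ _ tu uv).
    case: ow => [[s [su sk so]]|[_ ->]]; last first.
      by rewrite addn0 (leq_trans ktv)// r2.
    have [st|ts] := leP s t; first by have := r3 _ _ _ _ st tu uv; lia.
    by have := r1 _ _ _ (ltW ts) (ltW (lt_le_trans su uv)); lia.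
  rewrite leqNgt; apply/negP => tvk.
  have := tu; rewrite le_eqVlt => /predU1P[tE|tu']; first by subst u; lia.
  by have := om _ tu' tvk; lia.
suff key : (k <= r t v)%N -> offset (r^~ t) (r^~ v) t k =
    o + offset (r^~ t) (r^~ u) t (k + o).
  split=> [[j [jtu ->] [kuv jE]]|[ktv ->]].
    rewrite -/o in jE; subst j.
    have ktv : (k <= r t v)%N by apply/kP.
    by split; rewrite // key// addnA.
  have [kuv kotu] := kP.1 ktv.
  by exists (k + o); split=> //; rewrite key// addnA.
move=> ktv.
have lvlP s : (s < t)%O -> (r s v < k)%N <-> (r s u < k + o)%N.
  move=> st; have su := lt_le_trans st tu.
  split=> [sk|sko]; first by have := om _ su sk; lia.
  rewrite ltnNge; apply/negP => ks.
  case: ow => [[s0 [s0u s0k s0o]]|[_ o0]]; last first.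
    by have := r2 _ _ _ (ltW su) uv; lia.
  have [ss0|/ltW s0s] := leP s s0.
    by have := r1 _ _ _ ss0 (ltW (lt_le_trans s0u uv)); lia.
  by have := r3 _ _ _ _ s0s (ltW su) uv; lia.
have [] := offset_rank k rr tv; have [] := offset_rank (k + o) rr tu.
set q := offset _ _ t (k + o); set p := offset _ _ t k.
move=> qm qw pm pw; apply/eqP; rewrite eqn_leq; apply/andP; split.
  case: pw => [[s [st sk sp]]|[_ ->//]].
  have := om _ (lt_le_trans st tu) sk.
  by have := qm _ st ((lvlP _ st).1 sk); lia.
case: ow => [[s0 [s0u s0k s0o]]|[no o0]].
  have s0t : (s0 < t)%O.
    rewrite ltNge; apply/negP => ts0.
    by have := r1 _ _ _ ts0 (ltW (lt_le_trans s0u uv)); lia.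
  case: qw => [[s1 [s1t s1k s1q]]|[nq _]]; last by have := nq _ s0t; lia.
  have [s01|/ltW s10] := leP s0 s1.
    have := r3 _ _ _ _ s01 (ltW (lt_le_trans s1t tu)) uv.
    by have := pm _ s1t ((lvlP _ s1t).2 s1k); lia.
  have := r3 _ _ _ _ s10 (ltW s0t) tu.
  by have := pm _ s0t s0k; lia.
case: qw => [[s1 [s1t s1k s1q]]|[_ q0]]; last by lia.
have := (lvlP _ s1t).2 s1k; have := no _ (lt_le_trans s1t tu); lia.
Qed.

Lemma rank_like_dual (d : Order.disp_t) (T : porderType d) (r : T -> T -> nat) :
  rank_like r -> rank_like (fun s t : T^d => r t s).
Proof.
move=> [r1 r2 r3]; split=> [s s' t ss' s't|s t t' st tt'|s s' t t' ss' s't tt'].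
- exact: r2.
- exact: r1.
- by rewrite addnC [leqRHS]addnC; have := r3 _ _ _ _ tt' s't ss'; lia.
Qed.

Lemma D_epi_relE (R : realType) (K : fieldType) (M : pers_mod R K) (t u : R)
  (i j : nat) : D_epi_rel M t u i j = rank_rel (rank M) t u i j.
Proof. by []. Qed.

Lemma D_mono_relE (R : realType) (K : fieldType) (M : pers_mod R K) (t u : R)
  (i j : nat) :
  D_mono_rel M t u i j = rank_rel (fun s t : R^d => rank M t s) u t j i.
Proof. by []. Qed.

Program Definition D_epi_matching (R : realType) (K : fieldType)
    (M : pers_mod R K) (t u : R) (tu : (t <= u)%O) :
    matching (initial (pers_dim M t)) (initial (pers_dim M u)) :=
  @Matching _ _ (fun i j => D_epi_rel M t u (val i) (val j)) _ _.
Next Obligation.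
move=> R K M t u tu i j j' /= ij ij'; apply: val_inj => /=.
exact: (rank_rel_fun (rank_like_rank M) tu ij ij').
Qed.
Next Obligation.
by move=> R K M t u tu i i' j /= [_ ij] [_ i'j]; apply: val_inj; rewrite /= ij.
Qed.

Program Definition D_epi (R : realType) (K : fieldType) (M : pers_mod R K) :
    functor (poset_cat R) Mch :=
  @Functor (poset_cat R) Mch (fun t => initial (pers_dim M t))
    (@D_epi_matching R K M) _ _.
Next Obligation.
move=> R K M t; apply: matchingP => i j /=.
rewrite D_epi_relE (rank_rel_id _ _ _ (rank_like_rank M)) rank_id.
split=> [[_ ij]|->]; first exact: val_inj.
by split=> //; have /andP[] := valP j.
Qed.
Next Obligation.
move=> R K M t u v uv tu; apply: matchingP => i k /=.
rewrite D_epi_relE -(rank_rel_comp _ _ (rank_like_rank M) tu uv).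
split=> [[j ij jk]|[j ij jk]]; last by exists (val j).
have /andP[/andP[kj ju] _] := rank_rel_range (rank_like_rank M) uv jk.
have j_in : (0 < j <= pers_dim M u)%N.
  by rewrite -rank_id ju andbT (leq_trans _ kj)//; have /andP[] := valP k.
by exists (exist _ j j_in).
Qed.

Program Definition D_mono_matching (R : realType) (K : fieldType)
    (M : pers_mod R K) (t u : R) (tu : (t <= u)%O) :
    matching (initial (pers_dim M t)) (initial (pers_dim M u)) :=
  @Matching _ _ (fun i j => D_mono_rel M t u (val i) (val j)) _ _.
Next Obligation.
by move=> R K M t u tu i j j' /= [_ ij] [_ ij']; apply: val_inj; rewrite /= ij.
Qed.
Next Obligation.
move=> R K M t u tu i i' j /= ij i'j; apply: val_inj => /=.
exact: (rank_rel_fun (rank_like_dual (rank_like_rank M)) tu ij i'j).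
Qed.

Program Definition D_mono (R : realType) (K : fieldType) (M : pers_mod R K) :
    functor (poset_cat R) Mch :=
  @Functor (poset_cat R) Mch (fun t => initial (pers_dim M t))
    (@D_mono_matching R K M) _ _.
Next Obligation.
move=> R K M t; apply: matchingP => i j /=.
rewrite D_mono_relE (rank_rel_id _ _ _ (rank_like_dual (rank_like_rank M))).
rewrite rank_id; split=> [[_ ij]|->]; first exact: val_inj.
by split=> //; have /andP[] := valP j.
Qed.
Next Obligation.
move=> R K M t u v uv tu; apply: matchingP => i k /=.
have rr := rank_like_dual (rank_like_rank M).
rewrite D_mono_relE -(@rank_rel_comp _ R^d _ v u t _ _ rr uv tu).
split=> [[j kj ji]|[j ij jk]]; last by exists (val j).
have /andP[/andP[ij ju] _] := @rank_rel_range _ R^d _ u t _ _ rr tu ji.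
have j_in : (0 < j <= pers_dim M u)%N.
  by rewrite -rank_id ju andbT (leq_trans _ ij)//; have /andP[] := valP i.
by exists (exist _ j j_in).
Qed.

(* The pairs attached to f at t depend on M and N only. The conditions
   j <= dim N_t, resp. i <= dim M_t, are in the types of j and i. *)
Definition D_epi_map (R : realType) (K : fieldType) (M N : pers_mod R K)
    (f : mor M N) (t : R)
    (i : initial (pers_dim M t)) (j : initial (pers_dim N t)) : Prop :=
  val i = val j + max0 [set (rank M s t - rank N s t)%N
                         | s in [set s | (s < t)%O /\ (rank N s t < val j)%N]].

Definition D_mono_map (R : realType) (K : fieldType) (M N : pers_mod R K)
    (f : mor M N) (t : R)
    (i : initial (pers_dim M t)) (j : initial (pers_dim N t)) : Prop :=
  val j = val i + max0 [set (rank N t v - rank M t v)%N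
                         | v in [set v | (t < v)%O /\ (rank M t v < val i)%N]].

Arguments D_epi_map {R K M N} f t i j.
Arguments D_mono_map {R K M N} f t i j.

(* Main.v *)
(* The matchings of a surjection M ->> N follow the same formula as the internal
   matchings, so they behave like the matchings of a single module in which
   M sits below N. To make this precise, replace every point of the line by a
   chain of copies (R times nat, ordered lexicographically), and use the ranks
   of M up to a cut and those of N beyond it: the rank of M_s -> M_t -> N_t is
   that of N_s -> N_t, because M_s -> N_s is onto. These glued ranks satisfy the
   same three inequalities as the ranks of a module, so composition of the
   internal matchings yields both naturality and functoriality, by comparing
   two ways through the glued order. Monomorphisms are handled by reversing the
   order and exchanging M with N.
   Epimorphisms and monomorphisms are pointwise surjective and injective: they
   are tested against modules supported on a half-line. *)
From HB Require Import structures.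
Require Import Defs.
From mathcomp Require Import all_boot all_order all_algebra zify.
From mathcomp Require Import boolp classical_sets reals.

Set Implicit Arguments.
Unset Strict Implicit.
Unset Printing Implicit Defensive.

Import Order.TTheory GRing.Theory.

(* For M ->> N with ranks r and r', the second inequality compares the kernels
   of M_t -> N_t on the images of M_s and of M_s'. *)
Definition dominates (d : Order.disp_t) (T : porderType d)
    (r r' : T -> T -> nat) : Prop :=
  forall s s' t, (s <= s')%O -> (s' <= t)%O ->
    (r' s t <= r s t)%N /\ (r s t + r' s' t <= r s' t + r' s t)%N.

Lemma dominates_refl (d : Order.disp_t) (T : porderType d) (r : T -> T -> nat) :
  dominates r r.
Proof. by move=> s s' t _ _; split; rewrite // addnC. Qed.

Lemma dominates_trans (d : Order.disp_t) (T : porderType d)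
    (r1 r0 r2 : T -> T -> nat) :
  dominates r0 r1 -> dominates r1 r2 -> dominates r0 r2.
Proof.
move=> d1 d2 s s' t ss' s't.
by have := d1 _ _ _ ss' s't; have := d2 _ _ _ ss' s't; lia.
Qed.

(** For [r = r'] this is [rank_rel], for [t = u] the matching of a surjection at [t]; in general it
    is the diagonal from M_t to N_u of a naturality square. *)
Definition cross_rel (d : Order.disp_t) (T : porderType d)
    (r r' : T -> T -> nat) (t u : T) (i j : nat) : Prop :=
  (j <= r' t u)%N /\ i = j + offset (r^~ t) (r'^~ u) t j.

(** * Gluing ranks along the lexicographic order *)

Section Glue.
Variables (d : Order.disp_t) (T : orderType d).

(** The target alone selects the ranks. The third inequality is the sum of the one for [X y'] and of
    the kernel inequality between [X y] and [X y'] over [y]. *)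
Lemma rank_like_glue (X : T *l nat -> T -> T -> nat) :
  (forall y, rank_like (X y)) ->
  (forall y y', (y <= y')%O -> dominates (X y) (X y')) ->
  rank_like (fun x y : T *l nat => X y x.1 y.1).
Proof.
move=> rX dX.
have le1 (x y : T *l nat) : (x <= y)%O -> (x.1 <= y.1)%O.
  by rewrite leEprodlexi => /andP[].
split=> [x x' y xx' x'y|x y y' xy yy'|x x' y y' xx' x'y yy'].
- by have [r1 _ _] := rX y; apply: r1; exact: le1.
- have [_ r2 _] := rX y'.
  have [dle _] := dX _ _ yy' _ _ _ (lexx x.1) (le1 _ _ xy).
  exact: leq_trans (r2 _ _ _ (le1 _ _ xy) (le1 _ _ yy')) dle.
- have [_ _ r3] := rX y'.
  have := r3 _ _ _ _ (le1 _ _ xx') (le1 _ _ x'y) (le1 _ _ yy').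
  by have := dX _ _ yy' _ _ _ (le1 _ _ xx') (le1 _ _ x'y); lia.
Qed.

(* The points of T *l nat below y lie over points below y.1 or over y.1 itself;
   the latter do not contribute, since j is at most the rank from y.1. *)
Lemma rank_rel_glue (X : T *l nat -> T -> T -> nat) (y z : T *l nat)
    (i j : nat) :
  rank_rel (fun x y : T *l nat => X y x.1 y.1) y z i j =
  cross_rel (X y) (X z) y.1 z.1 i j.
Proof.
rewrite /rank_rel /cross_rel.
suff E : (j <= X z y.1 z.1)%N ->
    offset (fun x : T *l nat => X y x.1 y.1) (fun x => X z x.1 z.1) y j =
    offset (fun x => X y x y.1) (fun x => X z x z.1) y.1 j.
  by apply/propext; split=> -[jr ij]; split=> //; move: ij; rewrite E.
move=> jr; congr max0; apply/seteqP; split=> n /= [s [sy sj] <-].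
  exists s.1 => //; split=> //; move: sy; rewrite ltEprodlexi => /andP[le_sy _].
  rewrite lt_neqAle le_sy andbT.
  by apply/eqP => sE; move: sj; rewrite sE ltnNge jr.
by exists (s, 0) => //; split=> //; rewrite ltEprodlexi/= (ltW sy) leNgt sy.
Qed.

Variables (r0 r1 r2 : T -> T -> nat) (t u v : T).
Hypotheses (rl0 : rank_like r0) (rl1 : rank_like r1) (rl2 : rank_like r2).
Hypotheses (d01 : dominates r0 r1) (d12 : dominates r1 r2).
Hypotheses (tu : (t <= u)%O) (uv : (u <= v)%O).

(** The existential form lets facts on [rank_rel] carry over to [cross_rel] without further mention
    of the glued order. *)
Lemma cross_rel_glue : exists (dd : Order.disp_t) (Q : orderType dd)
    (r : Q -> Q -> nat) (x y z : Q),
  [/\ rank_like r, (x <= y)%O, (y <= z)%O & forall i j,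
   [/\ rank_rel r x y i j = cross_rel r0 r1 t u i j,
       rank_rel r y z i j = cross_rel r1 r2 u v i j,
       rank_rel r x z i j = cross_rel r0 r2 t v i j &
       r x x = r0 t t /\ r y y = r1 u u]].
Proof.
(* The second coordinates keep the three points distinct even when [t], [u] and [v] coincide, so the
   cuts in [X] separate the three ranks. *)
pose x : T *l nat := (t, 0); pose y : T *l nat := (u, 1).
pose z : T *l nat := (v, 2).
pose X (p : T *l nat) :=
  if (p <= x)%O then r0 else if (p <= y)%O then r1 else r2.
have xy : (x < y)%O by rewrite ltEprodlexi/= tu implybT.
have yz : (y < z)%O by rewrite ltEprodlexi/= uv implybT.
have Xx : X x = r0 by rewrite /X lexx.
have Xy : X y = r1 by rewrite /X leNgt xy lexx.
have Xz : X z = r2 by rewrite /X leNgt (lt_trans xy yz)/= leNgt yz.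
exists _, (T *l nat : orderType _), (fun p q : T *l nat => X q p.1 q.1).
exists x, y, z.
split; [|exact: ltW..|]; last first.
  by move=> i j; rewrite !rank_rel_glue Xx Xy Xz.
apply: rank_like_glue => [p|p q pq]; first by rewrite /X; do 2?case: ifP.
have d02 := dominates_trans d01 d12; have dr := @dominates_refl _ T.
rewrite /X; case: (leP q x) => [qx|_]; first by rewrite (le_trans pq qx).
case: (leP q y) => [qy|_]; first by rewrite (le_trans pq qy); case: ifP.
by case: ifP => // _; case: ifP.
Qed.

(** This is the composition law of [rank_rel] in the glued order. Naturality uses it with two equal
    ranks, functoriality with [t = u = v]. *)
Lemma cross_rel_comp (i k : nat) :
  (exists2 j, cross_rel r0 r1 t u i j & cross_rel r1 r2 u v j k) <->
  cross_rel r0 r2 t v i k.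
Proof.
have [dd [Q [r [x [y [z [rr xy yz E]]]]]]] := cross_rel_glue.
have [_ _ <- _] := E i k; rewrite -(rank_rel_comp _ _ rr xy yz).
by split=> -[j]; have [E1 _ _ _] := E i j; have [_ E2 _ _] := E j k;
  rewrite ?E1 ?E2; exists j; rewrite ?E1 ?E2.
Qed.

End Glue.

(** * Injectivity, range and monotonicity of the glued relations *)

Section CrossRel.
Variables (d : Order.disp_t) (T : orderType d) (r r' : T -> T -> nat).
Hypotheses (rl : rank_like r) (rl' : rank_like r') (dr : dominates r r').

Lemma cross_rel_fun (t u : T) (i j j' : nat) : (t <= u)%O ->
  cross_rel r r' t u i j -> cross_rel r r' t u i j' -> j = j'.
Proof.
(* Only two ranks are compared here; [r'] and [u] are repeated to fill the third place. *)
move=> tu; have [dd [Q [q [x [y [z [rq xy _ E]]]]]]] :=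
  cross_rel_glue rl rl' rl' dr (@dominates_refl _ _ r') tu (lexx u).
have [<- _ _ _] := E i j; have [<- _ _ _] := E i j'.
exact: rank_rel_fun.
Qed.

Lemma cross_rel_range (t u : T) (i j : nat) : (t <= u)%O ->
  cross_rel r r' t u i j -> (j <= i <= r t t)%N && (j <= r' u u)%N.
Proof.
move=> tu; have [dd [Q [q [x [y [z [rq xy _ E]]]]]]] :=
  cross_rel_glue rl rl' rl' dr (@dominates_refl _ _ r') tu (lexx u).
by have [<- _ _ [<- <-]] := E i j; exact: rank_rel_range.
Qed.

(** The offset is weakly increasing in [j], because its maximum runs over a growing set. *)
Lemma cross_rel_mono (t : T) (i j m n : nat) :
  cross_rel r r' t t i j -> cross_rel r r' t t m n -> (j < n)%N -> (i < m)%N.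
Proof.
move=> [_ ->] [_ ->] jn.
have le_r s : (s <= t)%O -> (r' s t <= r s t)%N.
  by move=> st; have [] := dr (lexx s) st.
have le_ker s : (s <= t)%O -> (r s t + r' t t <= r t t + r' s t)%N.
  by move=> st; have [] := dr st (lexx t).
have [om _] := offsetP n le_r le_ker; have [_ ow] := offsetP j le_r le_ker.
case: ow => [[s [st sj so]]|[_ ->]]; last by rewrite addn0; lia.
by move: sj so (om _ st (ltn_trans sj jn)) => /=; lia.
Qed.

End CrossRel.

(** * Total internal maps and interval modules *)

Section LinearAlgebra.
Variables (R : realType) (K : fieldType).

(** Total in [s] and [t], so that no proof of [s <= t] occurs in the terms to be rewritten; 0 is a
    junk value. *)
Definition pmor (M : pers_mod R K) (s t : R) : 'Hom(M s, M t) :=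
  if @idP (s <= t)%O is ReflectT st then fmap M st else 0%R.

Lemma pmorE (M : pers_mod R K) (s t : R) (st : (s <= t)%O) :
  pmor M s t = fmap M st.
Proof.
rewrite /pmor; case: {-}_ / idP => [st'|//].
by rewrite (bool_irrelevance st' st).
Qed.

Lemma pmor_id (M : pers_mod R K) (t : R) : pmor M t t = \1%VF.
Proof. by rewrite (pmorE M (lexx t)) (fmap1 M t). Qed.

Lemma pmor_comp (M : pers_mod R K) (s t u : R) :
  (s <= t)%O -> (t <= u)%O -> (pmor M t u \o pmor M s t)%VF = pmor M s u.
Proof.
move=> st tu; rewrite (pmorE M st) (pmorE M tu) (pmorE M (le_trans st tu)).
by rewrite -[LHS](fmapM M).
Qed.

Lemma pmor_nat (M N : pers_mod R K) (f : mor M N) (s t : R) : (s <= t)%O ->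
  (f t \o pmor M s t)%VF = (pmor N s t \o f s)%VF.
Proof. by move=> st; rewrite !(pmorE _ st); exact: (naturality f st). Qed.

Variable V : vectType K.

(** For [n = 1] the sum and the diagonal are mutually inverse, for [n = 0] both are 0; so one
    formula serves inside and outside an interval. *)
Definition ffun_total (n : nat) (x : {ffun 'I_n -> V}) : V := (\sum_i x i)%R.

Definition ffun_diag (n : nat) (v : V) : {ffun 'I_n -> V} := [ffun=> v].

Lemma ffun_total_is_linear (n : nat) : linear (@ffun_total n).
Proof.
move=> a x y; rewrite /ffun_total scaler_sumr -big_split.
by apply: eq_bigr => i _; rewrite !ffunE.
Qed.

Lemma ffun_diag_is_linear (n : nat) : linear (@ffun_diag n).
Proof. by move=> a x y; apply/ffunP => i; rewrite !ffunE. Qed.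

HB.instance Definition _ (n : nat) :=
  GRing.isLinear.Build K _ _ _ _ (@ffun_total_is_linear n).
HB.instance Definition _ (n : nat) :=
  GRing.isLinear.Build K _ _ _ _ (@ffun_diag_is_linear n).

Definition total_hom (n : nat) : 'Hom({ffun 'I_n -> V}, V) :=
  linfun (@ffun_total n).
Definition diag_hom (n : nat) : 'Hom(V, {ffun 'I_n -> V}) :=
  linfun (@ffun_diag n).

Lemma total_hom0 : total_hom 0 = 0%R.
Proof. by apply/lfunP => x; rewrite !lfunE /= /ffun_total big_ord0. Qed.

Lemma diag_hom0 : diag_hom 0 = 0%R.
Proof. by apply/lfunP => x; apply/ffunP => -[]. Qed.

Lemma total_diag_hom1 : (total_hom 1 \o diag_hom 1)%VF = \1%VF.
Proof.
apply/lfunP => v.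
by rewrite !lfunE /= !lfunE /= /ffun_total big_ord1 ffunE.
Qed.

Lemma diag_total_hom (b : bool) : (diag_hom b \o total_hom b)%VF = \1%VF.
Proof.
apply/lfunP => v; apply/ffunP; case: b v => v i; last by case: i.
by rewrite !lfunE /= !lfunE /= /ffun_total big_ord1 ffunE (ord1 i).
Qed.

(** If the middle point lies in the interval, its two maps cancel. Otherwise the left side is 0, and
    so is the right side, since one endpoint lies outside. *)
Lemma diag_total_hom_comp (b1 b2 b3 : bool) : (b1 && b3 ==> b2) ->
  ((diag_hom b3 \o total_hom b2) \o (diag_hom b2 \o total_hom b1))%VF
  = (diag_hom b3 \o total_hom b1)%VF.
Proof.
case: b2 => [_|].
  by rewrite comp_lfunA -(comp_lfunA (diag_hom _)) total_diag_hom1 comp_lfun1r.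
rewrite total_hom0 comp_lfun0r comp_lfun0l.
case: b1 b3 => [] [] //= _;
  by rewrite ?total_hom0 ?diag_hom0 ?comp_lfun0r ?comp_lfun0l.
Qed.

Variable b : R -> bool.
Hypothesis b_convex : forall s t u,
  (s <= t)%O -> (t <= u)%O -> b s && b u ==> b t.

(* V at the points of b and 0 elsewhere, as V^b with b cast to 0 or 1. *)
Definition interval_mod : pers_mod R K.
Proof.
refine (@Functor (poset_cat R) (vect_cat K)
  (fun s : R => ({ffun 'I_(b s) -> V} : vectType K))
  (fun (s t : R) _ => diag_hom (b t) \o total_hom (b s))%VF _ _).
- by move=> s; exact: diag_total_hom.
- by move=> s t u tu st; rewrite [RHS]diag_total_hom_comp// b_convex.
Defined.

End LinearAlgebra.

(** * Pointwise surjectivity and injectivity, and the resulting rank inequalities *)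

Section EpiMono.
Variables (R : realType) (K : fieldType).

Lemma le_convex (t s s' u : R) :
  (s <= s')%O -> (s' <= u)%O -> (s <= t)%O && (u <= t)%O ==> (s' <= t)%O.
Proof. by move=> _ s'u; apply/implyP => /andP[_]; exact: le_trans. Qed.

Lemma ge_convex (t s s' u : R) :
  (s <= s')%O -> (s' <= u)%O -> (t <= s)%O && (t <= u)%O ==> (t <= s')%O.
Proof. by move=> ss' _; apply/implyP => /andP[ts _]; apply: le_trans ss'. Qed.

(** A morphism to a module constant on (-oo, t] and 0 beyond is determined by its component at [t],
    here [p]. *)
Definition to_interval (N : pers_mod R K) (t : R) (p : 'End(N t)) :
  mor N (interval_mod (N t) (@le_convex t)).
Proof.
refine (@NatTrans (poset_cat R) (vect_cat K)
  N (interval_mod (N t) (@le_convex t))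
  (fun s : R => diag_hom (N t) (s <= t)%O \o (p \o pmor N s t))%VF _).
move=> s u su /=; case: (boolP (u <= t)%O) => [ut|_]; last first.
  by rewrite !diag_hom0 !comp_lfun0l.
rewrite -(pmorE N su) (le_trans su ut) -!comp_lfunA pmor_comp//.
by rewrite [in RHS](comp_lfunA (total_hom _ _)) total_diag_hom1 comp_lfun1l.
Defined.

Definition from_interval (M : pers_mod R K) (t : R) (p : 'End(M t)) :
  mor (interval_mod (M t) (@ge_convex t)) M.
Proof.
refine (@NatTrans (poset_cat R) (vect_cat K)
  (interval_mod (M t) (@ge_convex t)) M
  (fun s : R => (pmor M t s \o p) \o total_hom (M t) (t <= s)%O)%VF _).
move=> s u su /=; case: (boolP (t <= s)%O) => [ts|_]; last first.
  by rewrite !total_hom0 !comp_lfun0r.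
rewrite -(pmorE M su) (le_trans ts su) !comp_lfunA pmor_comp//.
by rewrite -(comp_lfunA _ (total_hom _ _)) total_diag_hom1 comp_lfun1r.
Defined.

(** The identity of N_t and the projection onto the image of [f t] induce morphisms that agree after
    [f], hence are equal. *)
Lemma epi_limg (M N : pers_mod R K) (f : mor M N) (t : R) :
  is_epi f -> limg (f t) = fullv.
Proof.
move=> f_epi.
(* Composing with [total_hom] at [t] recovers the endomorphism of N_t. *)
have /(congr1 (fun h : mor N (interval_mod (N t) (@le_convex t)) =>
     (total_hom (N t) (t <= t)%O \o h t)%VF)) :
    to_interval \1%VF = to_interval (projv (limg (f t))).
  apply: f_epi; apply: nat_transP => s /=.
  rewrite -!comp_lfunA comp_lfun1l.
  case: (boolP (s <= t)%O) => [st|_]; last first.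
    by rewrite !diag_hom0 !comp_lfun0l.
  congr (_ \o _)%VF; rewrite -pmor_nat// comp_lfunA; congr (_ \o _)%VF.
  by apply/lfunP => x; rewrite lfunE /= projv_id// memv_img ?memvf.
rewrite /= lexx !comp_lfunA total_diag_hom1 !comp_lfun1l pmor_id comp_lfun1r.
by move=> E; rewrite -[LHS]limg_proj -E lim1g.
Qed.

(** Dually, the projection onto the kernel of [f t] and 0 induce morphisms from a module supported
    on [t, +oo) that agree before [f]. *)
Lemma mono_lker (M N : pers_mod R K) (f : mor M N) (t : R) :
  is_mono f -> lker (f t) = 0%VS.
Proof.
move=> f_mono.
have /(congr1 (fun h : mor (interval_mod (M t) (@ge_convex t)) M =>
     (h t \o diag_hom (M t) (t <= t)%O)%VF)) :
    from_interval (projv (lker (f t))) = from_interval 0%R.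
  apply: f_mono; apply: nat_transP => s /=.
  rewrite comp_lfun0r comp_lfun0l comp_lfun0r comp_lfunA.
  case: (boolP (t <= s)%O) => [ts|_]; last by rewrite total_hom0 comp_lfun0r.
  rewrite comp_lfunA pmor_nat// -(comp_lfunA (pmor _ _ _)).
  suff -> : (f t \o projv (lker (f t)))%VF = 0%R.
    by rewrite comp_lfun0r comp_lfun0l.
  apply/lfunP => x; rewrite lfunE /= lfunE /=.
  by apply/eqP; rewrite -memv_ker memv_proj.
rewrite /= lexx -!comp_lfunA total_diag_hom1 !comp_lfun1r pmor_id !comp_lfun1l.
by move=> E; rewrite -[LHS]limg_proj E lim0g.
Qed.

Lemma rank_pmor (M : pers_mod R K) (s t : R) :
  (s <= t)%O -> rank M s t = \dim (limg (pmor M s t)).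
Proof. by move=> st; rewrite (rankE M st) (pmorE M st). Qed.

(** By naturality, precomposing N_s -> N_t with the surjection [f s] keeps its image. *)
Lemma rank_epi (M N : pers_mod R K) (f : mor M N) (s t : R) :
  is_epi f -> (s <= t)%O -> rank N s t = \dim (f t @: limg (pmor M s t)).
Proof.
by move=> fe st; rewrite rank_pmor// -limg_comp pmor_nat// limg_comp epi_limg.
Qed.

Lemma dim_img_mono (U W : vectType K) (f : 'Hom(U, W)) (A : {vspace U}) :
  lker f = 0%VS -> \dim (f @: A) = \dim A.
Proof. by move=> kf; apply: limg_dim_eq; rewrite kf capv0. Qed.

(** By rank-nullity, this says that the kernel of [f] on [A] is at most as large as that on [B]. *)
Lemma dim_img_sub (U W : vectType K) (f : 'Hom(U, W)) (A B : {vspace U}) :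
  (A <= B)%VS -> (\dim A + \dim (f @: B) <= \dim B + \dim (f @: A))%N.
Proof.
move=> AB; rewrite -(limg_ker_dim f A) -(limg_ker_dim f B).
by rewrite addnAC leq_add2r leq_add2r dimvS// capvS.
Qed.

Lemma limg_pmorS (M : pers_mod R K) (s s' t : R) :
  (s <= s')%O -> (s' <= t)%O -> (limg (pmor M s t) <= limg (pmor M s' t))%VS.
Proof.
by move=> ss' s't; rewrite -(pmor_comp M ss' s't) limg_comp limgS// subvf.
Qed.

Lemma rank_epi_dominates (M N : pers_mod R K) (f : mor M N) :
  is_epi f -> dominates (rank M) (rank N).
Proof.
move=> fe s s' t ss' s't; have st := le_trans ss' s't.
rewrite !(rank_epi fe)// !rank_pmor//; split.
  by rewrite -[leqRHS](limg_ker_dim (f t)) leq_addl.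
by rewrite dim_img_sub// limg_pmorS.
Qed.

Lemma rank_mono_dominates (M N : pers_mod R K) (f : mor M N) : is_mono f ->
  dominates (fun s t : R^d => rank N t s) (fun s t : R^d => rank M t s).
Proof.
move=> fm u v t /= uv vt.
(* The hypotheses are reread in the original order of [R], where [t <= v <= u]. *)
have {uv}vu : ((v : R) <= u)%O by [].
have {vt}tv : ((t : R) <= v)%O by [].
have tu := le_trans tv vu.
have imf x : (t <= x :> R)%O ->
    (f x @: limg (pmor M t x) <= limg (pmor N t x))%VS.
  by move=> tx; rewrite -limg_comp pmor_nat// limg_comp limgS// subvf.
have dimf x : (t <= x :> R)%O -> \dim (f x @: limg (pmor M t x)) = rank M t x.
  by move=> tx; rewrite rank_pmor// dim_img_mono// mono_lker.
split; first by rewrite -dimf// rank_pmor// dimvS// imf.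
(* The kernels compared are those of N_v -> N_u on the images of M_t and of N_t in N_v. *)
have := dim_img_sub (pmor N v u) (imf v tv).
rewrite -!limg_comp comp_lfunA -pmor_nat// -!comp_lfunA !pmor_comp//.
by rewrite !limg_comp !dimf// -!rank_pmor//; lia.
Qed.

End EpiMono.

(** * Epimorphisms and monomorphisms of matchings; restriction to initial segments *)

Section Matchings.

(** Over [R^d] the two factors of a composite occur in reverse order. *)
Lemma exists2C (A : Type) (P Q : A -> Prop) :
  (exists2 x, P x & Q x) = (exists2 x, Q x & P x).
Proof. by apply/propext; split=> -[x]; exists x. Qed.

Lemma is_epi_comp (C : category) (x y z : C) (g : mor y z) (f : mor x y) :
  is_epi g -> is_epi f -> is_epi (mcomp g f).
Proof. by move=> ge fe w h k; rewrite !mcompA => /fe/ge. Qed.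

Lemma is_mono_comp (C : category) (x y z : C) (g : mor y z) (f : mor x y) :
  is_mono g -> is_mono f -> is_mono (mcomp g f).
Proof. by move=> gm fm w h k; rewrite -!mcompA => /gm/fm. Qed.

Lemma componentwise_epi (C D : category) (F G : functor_cat C D)
    (a : mor F G) : (forall x, is_epi (a x)) -> is_epi a.
Proof.
move=> ae H g h E; apply: nat_transP => x; apply: (ae x).
exact: (congr1 (fun k : mor F H => k x) E).
Qed.

Lemma componentwise_mono (C D : category) (F G : functor_cat C D)
    (a : mor F G) : (forall x, is_mono (a x)) -> is_mono a.
Proof.
move=> ae H g h E; apply: nat_transP => x; apply: (ae x).
exact: (congr1 (fun k : mor H G => k x) E).
Qed.

Lemma coinjection_epi (A B : Type) (s : matching A B) :
  (forall b, exists a, s a b) -> is_epi (C := Mch) s.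
Proof.
move=> s_onto C; have sub (g h : matching B C) b c :
    matching_comp g s = matching_comp h s -> g b c -> h b c.
  have [a sab] := s_onto b => E gbc.
  have : matching_comp h s a c by rewrite -E; exists b.
  by move=> [b' sab' hbc]; rewrite (matching_fun sab sab').
by move=> g h E; apply: matchingP => b c; split; apply: sub.
Qed.

Lemma injection_mono (A B : Type) (s : matching A B) :
  (forall a, exists b, s a b) -> is_mono (C := Mch) s.
Proof.
move=> s_total C; have sub (g h : matching C A) c a :
    matching_comp s g = matching_comp s h -> g c a -> h c a.
  have [b sab] := s_total a => E gca.
  have : matching_comp s h c b by rewrite -E; exists a.
  by move=> [a' hca' sab']; rewrite (matching_inj sab sab').
by move=> g h E; apply: matchingP => b c; split; apply: sub.
Qed.

Variables (d : Order.disp_t) (T : orderType d).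

Lemma cross_rel_comp_initial (r0 r1 r2 : T -> T -> nat) (t u v : T) (n : nat)
    (i k : nat) :
  rank_like r0 -> rank_like r1 -> rank_like r2 ->
  dominates r0 r1 -> dominates r1 r2 -> (t <= u)%O -> (u <= v)%O ->
  r1 u u = n -> (0 < k)%N ->
  (exists2 j : initial n, cross_rel r0 r1 t u i (val j) &
                          cross_rel r1 r2 u v (val j) k) <->
  cross_rel r0 r2 t v i k.
Proof.
move=> rl0 rl1 rl2 d01 d12 tu uv rn k0.
rewrite -(cross_rel_comp rl0 rl1 rl2 d01 d12 tu uv).
split=> -[j ij jk]; first by exists (val j).
(* The bounds [0 < k <= j <= n] place the middle index in the segment. *)
have /andP[/andP[kj ju] _] := cross_rel_range rl1 rl2 d12 uv jk.
have j_in : (0 < j <= n)%N by rewrite (leq_trans k0 kj) -rn.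
by exists (exist _ j j_in).
Qed.

Lemma cross_rel_source (r r' : T -> T -> nat) (t : T)
    (n m : nat) (j : initial m) :
  rank_like r -> rank_like r' -> dominates r r' -> r t t = n ->
  r' t t = m -> exists i : initial n, cross_rel r r' t t (val i) (val j).
Proof.
move=> rl rl' dr rn rm; have /andP[j0 jm] := valP j.
have jr :
    cross_rel r r' t t (val j + offset (r^~ t) (r'^~ t) t (val j)) (val j).
  by split; rewrite ?rm.
have /andP[/andP[ji it] _] := cross_rel_range rl rl' dr (lexx t) jr.
have i_in : (0 < val j + offset (r^~ t) (r'^~ t) t (val j) <= n)%N.
  by rewrite -rn it (leq_trans j0 ji).
by exists (exist (fun i => 0 < i <= n)%N _ i_in).
Qed.

End Matchings.

(** * The induced matchings, their naturality and functoriality *)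

Section InducedMatchings.
Variables (R : realType) (K : fieldType).
Implicit Types M N O : pers_mod R K.

Notation rkd M := (fun s t : R^d => rank M t s).

Lemma rank_like_rkd M : rank_like (rkd M).
Proof. exact: rank_like_dual (rank_like_rank M). Qed.

(** The rank bound in [cross_rel] reads j <= dim N_t at [t = u], which the type of [j] provides. *)
Lemma D_epi_mapE M N (f : mor M N) t :
  D_epi_map f t = fun i j => cross_rel (rank M) (rank N) t t (val i) (val j).
Proof.
apply/funext => i; apply/funext => j; apply/propext.
split=> [ij|[]//]; split=> //.
by rewrite rank_id; have /andP[] := valP j.
Qed.

Lemma D_mono_mapE M N (f : mor M N) t :
  D_mono_map f t =
  fun i j => @cross_rel _ R^d (rkd N) (rkd M) t t (val j) (val i).
Proof.
apply/funext => i; apply/funext => j; apply/propext.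
split=> [ij|[]//]; split=> //.
by rewrite rank_id; have /andP[] := valP i.
Qed.

Lemma initial_gt0 (n : nat) (i : initial n) : (0 < val i)%N.
Proof. by have /andP[] := valP i. Qed.

Section Epi.
Variables (M N : pers_mod R K) (f : mor M N) (f_epi : is_epi f).
Let dom := rank_epi_dominates f_epi.
Let rM := rank_like_rank M.
Let rN := rank_like_rank N.

Lemma D_epi_map_fun t i j j' :
  D_epi_map f t i j -> D_epi_map f t i j' -> j = j'.
Proof.
rewrite !D_epi_mapE => ij ij'; apply: val_inj.
exact: (cross_rel_fun rM rN dom (lexx t) ij ij').
Qed.

Lemma D_epi_map_inj t i i' j :
  D_epi_map f t i j -> D_epi_map f t i' j -> i = i'.
Proof. by move=> ij i'j; apply: val_inj; rewrite /= ij. Qed.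

Definition D_epi_map_matching t : matching _ _ :=
  Matching (@D_epi_map_fun t) (@D_epi_map_inj t).

Lemma D_epi_map_order_preserving t : order_preserving (D_epi_map_matching t).
Proof.
move=> i m j n /=; rewrite !D_epi_mapE => ij mn jn.
exact: (cross_rel_mono dom ij mn).
Qed.

Lemma D_epi_map_epi t : is_epi (C := Mch) (D_epi_map_matching t).
Proof.
apply: coinjection_epi => j.
have [i ij] := cross_rel_source j rM rN dom (rank_id M t) (rank_id N t).
by exists i; rewrite /= D_epi_mapE.
Qed.

Lemma D_epi_map_natural t u (tu : (t <= u)%O) :
  matching_comp (D_epi_map_matching u) (D_epi_matching M tu) =
  matching_comp (D_epi_matching N tu) (D_epi_map_matching t).
Proof.
have dMM := @dominates_refl _ _ (rank M).
have dNN := @dominates_refl _ _ (rank N).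
apply: matchingP => i k /=; rewrite !D_epi_mapE; have k0 := initial_gt0 k.
(* Both ways around the square yield the relation from M_t to N_u. *)
have viaM := cross_rel_comp_initial (val i) rM rM rN dMM dom tu (lexx u)
  (rank_id M u) k0.
have viaN := cross_rel_comp_initial (val i) rM rN rN dom dNN (lexx t) tu
  (rank_id N t) k0.
exact (iff_trans viaM (iff_sym viaN)).
Qed.

Definition D_epi_trans : nat_trans (D_epi M) (D_epi N) :=
  @NatTrans (poset_cat R) Mch (D_epi M) (D_epi N) D_epi_map_matching
    D_epi_map_natural.

End Epi.

Section Mono.
Variables (M N : pers_mod R K) (f : mor M N) (f_mono : is_mono f).
Let dom := rank_mono_dominates f_mono.
Let rM := rank_like_rkd M.
Let rN := rank_like_rkd N.

Lemma D_mono_map_fun t i j j' :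
  D_mono_map f t i j -> D_mono_map f t i j' -> j = j'.
Proof. by move=> ij ij'; apply: val_inj; rewrite /= ij. Qed.

Lemma D_mono_map_inj t i i' j :
  D_mono_map f t i j -> D_mono_map f t i' j -> i = i'.
Proof.
rewrite !D_mono_mapE => ij i'j; apply: val_inj.
exact: (@cross_rel_fun _ R^d _ _ rN rM dom _ _ _ _ _ (lexx t) ij i'j).
Qed.

Definition D_mono_map_matching t : matching _ _ :=
  Matching (@D_mono_map_fun t) (@D_mono_map_inj t).

(** Source and target are exchanged in [D_mono_mapE], so [cross_rel_mono] only shows that [m < i]
    implies [n < j]. Totality of the order reduces the claim to this and to [m = i], where
    [j = n]. *)
Lemma D_mono_map_order_preserving t : order_preserving (D_mono_map_matching t).
Proof.
move=> i m j n /= ij mn jn; rewrite ltNge le_eqVlt; apply/negP.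
case/predU1P=> [mi|mi].
  by rewrite mi in mn; rewrite (D_mono_map_fun ij mn) ltxx in jn.
move: ij mn; rewrite !D_mono_mapE => ij mn.
have nj : (n < j)%O := @cross_rel_mono _ R^d _ _ dom _ _ _ _ _ mn ij mi.
by have := lt_trans jn nj; rewrite ltxx.
Qed.

Lemma D_mono_map_mono t : is_mono (C := Mch) (D_mono_map_matching t).
Proof.
apply: injection_mono => i.
have [j ij] := @cross_rel_source _ R^d _ _ t _ _ i rN rM dom
  (rank_id N t) (rank_id M t).
by exists j; rewrite /= D_mono_mapE.
Qed.

Lemma D_mono_map_natural t u (tu : (t <= u)%O) :
  matching_comp (D_mono_map_matching u) (D_mono_matching M tu) =
  matching_comp (D_mono_matching N tu) (D_mono_map_matching t).
Proof.
have dMM := @dominates_refl _ R^d (rkd M).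
have dNN := @dominates_refl _ R^d (rkd N).
apply: matchingP => i k /=; rewrite !D_mono_mapE; have i0 := initial_gt0 i.
(* In [R^d] the point [u] precedes [t], so the common diagonal runs from N_u to M_t. *)
have viaM := @cross_rel_comp_initial _ R^d _ _ _ u u t _ (val k) _ rN rM rM dom
  dMM (lexx _) tu (rank_id M u) i0.
have viaN := @cross_rel_comp_initial _ R^d _ _ _ u t t _ (val k) _ rN rN rM dNN
  dom tu (lexx _) (rank_id N t) i0.
rewrite exists2C [X in _ <-> X]exists2C.
exact (iff_trans viaM (iff_sym viaN)).
Qed.

Definition D_mono_trans : nat_trans (D_mono M) (D_mono N) :=
  @NatTrans (poset_cat R) Mch (D_mono M) (D_mono N) D_mono_map_matching
    D_mono_map_natural.

End Mono.

Lemma D_epi_trans_comp M N O (f : mor M N) (g : mor N O)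
    (fe : is_epi f) (ge : is_epi g) (gfe : is_epi (mcomp g f)) :
  D_epi_trans gfe = nat_trans_comp (D_epi_trans ge) (D_epi_trans fe).
Proof.
apply: nat_transP => t; apply: matchingP => i k /=; rewrite !D_epi_mapE.
(* Three copies of the same point [t] carry the ranks of [M], [N] and [O]. *)
have gf := cross_rel_comp_initial (val i) (rank_like_rank M)
  (rank_like_rank N) (rank_like_rank O) (rank_epi_dominates fe)
  (rank_epi_dominates ge) (lexx t) (lexx t) (rank_id N t) (initial_gt0 k).
exact (iff_sym gf).
Qed.

Lemma D_mono_trans_comp M N O (f : mor M N) (g : mor N O)
    (fm : is_mono f) (gm : is_mono g) (gfm : is_mono (mcomp g f)) :
  D_mono_trans gfm = nat_trans_comp (D_mono_trans gm) (D_mono_trans fm).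
Proof.
apply: nat_transP => t; apply: matchingP => i k /=; rewrite !D_mono_mapE.
have gf := @cross_rel_comp_initial _ R^d _ _ _ t t t _ (val k) _
  (rank_like_rkd O) (rank_like_rkd N) (rank_like_rkd M)
  (rank_mono_dominates gm) (rank_mono_dominates fm) (lexx _) (lexx _)
  (rank_id N t) (initial_gt0 i).
rewrite [X in _ <-> X]exists2C; exact (iff_sym gf).
Qed.

End InducedMatchings.

Theorem proposition5p6 (R : realType) (K : fieldType) :
  (forall (M N : pers_mod R K) (f : mor M N), is_epi f ->
    (forall t : R,
      exists2 s : matching (initial (pers_dim M t)) (initial (pers_dim N t)),
        mrel s = D_epi_map f t & order_preserving s /\ is_epi (C := Mch) s) /\
    (exists Df : nat_trans (D_epi M) (D_epi N),
      [/\ forall t : R, mrel (Df t) = D_epi_map f t,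
          is_epi (C := functor_cat (poset_cat R) Mch) Df
        & forall (O : pers_mod R K) (g : mor N O), is_epi g ->
            exists (Dg : nat_trans (D_epi N) (D_epi O))
                   (Dgf : nat_trans (D_epi M) (D_epi O)),
              [/\ forall t : R, mrel (Dg t) = D_epi_map g t,
                  forall t : R, mrel (Dgf t) = D_epi_map (mcomp g f) t
                & Dgf = mcomp (c := functor_cat (poset_cat R) Mch) Dg Df]])) /\
  (forall (M N : pers_mod R K) (f : mor M N), is_mono f ->
    (forall t : R,
      exists2 s : matching (initial (pers_dim M t)) (initial (pers_dim N t)),
        mrel s = D_mono_map f t & order_preserving s /\ is_mono (C := Mch) s) /\
    (exists Df : nat_trans (D_mono M) (D_mono N),
      [/\ forall t : R, mrel (Df t) = D_mono_map f t,
          is_mono (C := functor_cat (poset_cat R) Mch) Df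
        & forall (O : pers_mod R K) (g : mor N O), is_mono g ->
            exists (Dg : nat_trans (D_mono N) (D_mono O))
                   (Dgf : nat_trans (D_mono M) (D_mono O)),
              [/\ forall t : R, mrel (Dg t) = D_mono_map g t,
                  forall t : R, mrel (Dgf t) = D_mono_map (mcomp g f) t
                & Dgf = mcomp (c := functor_cat (poset_cat R) Mch) Dg Df]])).
Proof.
split=> M N f f_em.
  split=> [t|].
    exists (D_epi_map_matching f_em t) => //; split.
      exact: D_epi_map_order_preserving.
    exact: D_epi_map_epi.
  exists (D_epi_trans f_em); split=> // [|O g g_epi].
    by apply: componentwise_epi => t; exact: D_epi_map_epi.
  exists (D_epi_trans g_epi), (D_epi_trans (is_epi_comp g_epi f_em)).
  by split=> //; exact: D_epi_trans_comp.
split=> [t|].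
  exists (D_mono_map_matching f_em t) => //; split.
    exact: D_mono_map_order_preserving.
  exact: D_mono_map_mono.
exists (D_mono_trans f_em); split=> // [|O g g_mono].
  by apply: componentwise_mono => t; exact: D_mono_map_mono.
exists (D_mono_trans g_mono), (D_mono_trans (is_mono_comp g_mono f_em)).
by split=> //; exact: D_mono_trans_comp.
Qed.
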